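(* Let $X$ be a Baire metric space and let $Y$ be a closed convex subset of $\mathbb{R}^d$. Then $\mathcal{C}(X,Y)$ is dense in $\mathcal{M}(X,Y)$.
   Context: A set-valued map $g:X\to Y$ is usco if $g(x)$ is a nonempty compact subset of $Y$ for each $x\in X$ and $\{x\in X: g(x)\subset U\}$ is open in $X$ for each open $U\subset Y$. Set-valued maps are identified with their graphs, so $h\subset g$ means $h(x)\subset g(x)$ for all $x\in X$. A usco map $g$ is minimal if $h=g$ for every usco $h:X\to Y$ with $h\subset g$. $\mathcal{M}(X,Y)$ is the set of all minimal usco maps from $X$ to $Y$. For a usco map $g$, $[g]=\{f\in\mathcal{M}(X,Y): f\subset g\}$. $\mathcal{C}(X,Y)\subset\mathcal{M}(X,Y)$ is the set of continuous functions $f:X\to Y$, each identified with the set-valued map $x\mapsto\{f(x)\}$. A filter $\mathcal{F}$ on $\mathcal{M}(X,Y)$ converges to $f\in\mathcal{M}(X,Y)$ if $\{f\}=\bigcap\{[g]: g:X\to Y \text{ usco},\ [g]\in\mathcal{F}\}$ (in particular at least one usco $g$ with $[g]\in\mathcal{F}$ is required to exist). A subset $A\subset\mathcal{M}(X,Y)$ is closed if $f\in A$ whenever $\mathcal{F}$ is a filter converging to $f$ with $A\in\mathcal{F}$. The closure of a set is the smallest closed set containing it, and a set is dense if its closure is all of $\mathcal{M}(X,Y)$. *)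

(* Defs.v *)
From HB Require Import structures.
From mathcomp Require Import all_boot all_order all_algebra.
From mathcomp Require Import all_classical all_reals all_analysis.

Set Implicit Arguments.
Unset Strict Implicit.
Unset Printing Implicit Defensive.

Import Order.TTheory GRing.Theory Num.Theory.
Import numFieldNormedType.Exports.

Local Open Scope classical_set_scope.

Definition baire_space (X : topologicalType) : Prop :=
  forall O : (set X)^nat,
    (forall n, open (O n) /\ dense (O n)) -> dense (\bigcap_n O n).

(* A set-valued map from X to Y is a function X -> set Y. A subset Y of a
   space T is used as a target through the type [set_type Y], which carries the
   topology induced by T. *)

Definition usco (X Y : topologicalType) (g : X -> set Y) : Prop :=
  (forall x, g x !=set0 /\ compact (g x)) /\
  (forall U : set Y, open U -> open [set x | g x `<=` U]).

Definition graph_sub (X Y : Type) (h g : X -> set Y) : Prop :=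
  forall x, h x `<=` g x.

(* Used below as a type, through the coercion of sets to types. *)
Definition minimal_usco (X Y : topologicalType) : set (X -> set Y) :=
  [set g | usco g /\
    forall h : X -> set Y, usco h -> graph_sub h g -> h = g].
Arguments minimal_usco X Y : clear implicits.

Definition minimal_below (X Y : topologicalType) (g : X -> set Y) :
    set (minimal_usco X Y) :=
  [set f | graph_sub (val f) g].

(* The existence clause matters because an intersection over an empty family
   is the full set. *)
Definition usco_converges (X Y : topologicalType)
    (F : set_system (minimal_usco X Y)) (f : minimal_usco X Y) : Prop :=
  (exists g : X -> set Y, usco g /\ F (minimal_below g)) /\
  [set f] =
    \bigcap_(g in [set g : X -> set Y | usco g /\ F (minimal_below g)])
      minimal_below g.

Definition usco_closed (X Y : topologicalType) (A : set (minimal_usco X Y)) :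
    Prop :=
  forall (F : set_system (minimal_usco X Y)) (f : minimal_usco X Y),
    ProperFilter F -> usco_converges F f -> F A -> A f.

Definition usco_closure (X Y : topologicalType) (A : set (minimal_usco X Y)) :
    set (minimal_usco X Y) :=
  smallest (@usco_closed X Y) A.

Lemma usco_closure_closed (X Y : topologicalType)
    (A : set (minimal_usco X Y)) : usco_closed (usco_closure A).
Proof.
move=> F f FF Ff FA B [cB AB]; apply: (cB F f FF Ff).
by apply: filterS FA; apply: smallest_sub.
Qed.

Definition usco_dense (X Y : topologicalType) (A : set (minimal_usco X Y)) :
    Prop :=
  usco_closure A = setT.

Definition continuous_usco (X Y : topologicalType) : set (minimal_usco X Y) :=
  [set f | exists2 phi : X -> Y,
    continuous phi & val f = (fun x => [set phi x])].
Arguments continuous_usco X Y : clear implicits.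

(* Every continuous map does occur in [continuous_usco]. *)
Lemma continuous_minimal_usco (X Y : topologicalType) (phi : X -> Y) :
  continuous phi -> minimal_usco X Y (fun x => [set phi x]).
Proof.
move=> cphi; split.
  split=> [x|U oU]; first by split; [exists (phi x)|exact: compact_set1].
  have -> : [set x | [set phi x] `<=` U] = phi @^-1` U.
    by apply/seteqP; split=> x /= => [/(_ (phi x) erefl)|Ux _ ->].
  by move/continuousP: cphi; apply.
move=> h [hne _] hphi; apply/funext => x; apply/seteqP; split; first exact: hphi.
by move=> _ ->; have [[y hy] _] := hne x; rewrite -(hphi x y hy).
Qed.

(* Main.v *)
Require Import Defs.
From mathcomp Require Import all_boot all_order all_algebra.
From mathcomp Require Import all_classical all_reals all_analysis.
From mathcomp Require Import ring lra.
Import numFieldNormedType.Exports.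

Set Implicit Arguments.
Unset Strict Implicit.
Unset Printing Implicit Defensive.

Import Order.TTheory GRing.Theory Num.Theory.

Local Open Scope classical_set_scope.
Local Open Scope ring_scope.

(* Let f be a minimal usco map and s a selection of f. By minimality and the
   Baire property, f is single-valued and s is continuous at the points of a
   dense set D, and a usco map g contains f as soon as g meets f on D. Hence
   f is the limit of any sequence of continuous maps phi_n that is locally
   bounded, uniformly in n, and satisfies phi_n(z) -> s(x) as n -> oo and
   z -> x, for all x in D. Such a sequence is obtained without partitions of
   unity: multiply s by a positive Lipschitz weight that makes it bounded,
   regularize each coordinate by infimal convolution with n * dist, divide by
   the weight, and project onto Y by the (continuous) nearest-point map. *)

(** * Closed graphs, intersections and minimality of usco maps *)

(** [h x] is closed in [K]. For upper semicontinuity, the compact set [K] minus [O] is missed by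
    [h x], so the closed graph and a tube argument give a neighbourhood [U] of [x] and an open set
    around this compact that [h] misses over [U]. The last hypothesis is then applied to the union
    of that open set with [O]. *)
Lemma closed_graph_usco (X Y : topologicalType) (h : X -> set Y) :
  (forall x, h x !=set0) -> closed [set p : X * Y | h p.1 p.2] ->
  (forall x, exists K : set Y, [/\ compact K, h x `<=` K &
    forall O : set Y, open O -> K `<=` O -> \forall z \near x, h z `<=` O]) ->
  usco h.
Proof.
move=> hne hcl hK.
have hopen x y : ~ h x y -> \forall y' \near y & z \near x, ~ h z y'.
  move=> nhxy.
  have : nbhs (x, y) (~` [set p : X * Y | h p.1 p.2]).
    by apply: open_nbhs_nbhs; split => //; exact: closed_openC.
  case=> -[U V] [/= Ux Vy] UV; exists (V, U) => // -[y' z] [/= Vy' Uz].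
  exact: (UV (z, y')).
split=> [x|O oO].
  split=> //; have [K [cK hxK _]] := hK x.
  apply: (subclosed_compact _ cK hxK) => y clhy; apply: contrapT => /hopen.
  case=> -[V U] [/= Vy Ux] VU.
  have [y' [hxy' Vy']] := clhy _ Vy.
  by apply: (VU (y', x)) => //; split=> //; exact: nbhs_singleton.
rewrite openE => x /= hxO; rewrite /interior.
have [K [cK hxK Kx]] := hK x.
have cKO : compact (K `&` ~` O).
  by apply: compact_closedI => //; exact: open_closedC.
pose P (U : set X) (y : Y) := \forall y' \near y, forall z, U z -> ~ h z y'.
have : \forall U \near powerset_filter_from (nbhs x), (K `&` ~` O) `<=` P U.
  have := proj1 (compact_near_coveringP _) cKO _
    (powerset_filter_from (nbhs x)).
  apply=> y [Ky Oy].
  have /hopen[[V U] [/= Vy Ux] VU] : ~ h x y by move/hxO.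
  exists (V°, [set W | W `<=` U]) => /=.
    split; first exact: nbhs_interior.
    exact: small_set_sub.
  move=> [y' W] [/= Vy' WU]; apply: filterS Vy' => y'' Vy'' z /WU Uz.
  exact: (VU (y'', z)).
case/near_powerset_filter_fromP => [A B AB PB y Ky|U Ux KU].
  by apply: filterS (PB y Ky) => y' By' z /AB; exact: By'.
near=> z.
have : h z `<=` O `|` [set y | forall z, U z -> ~ h z y]°.
  near: z; apply: Kx; first by apply: openU => //; exact: open_interior.
  move=> y Ky; have [Oy|Oy] := pselect (O y); [by left|right].
  exact: KU.
move=> hz y hzy; case: (hz y hzy) => // /interior_subset /= /(_ z) [] //.
by near: z.
Unshelve. all: by end_near. Qed.

Lemma hausdorff_usco_closed_graph (R : realType) (X : topologicalType)
    (Y : pseudoMetricType R) (g : X -> set Y) :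
  hausdorff_space Y -> usco g -> closed [set p : X * Y | g p.1 p.2].
Proof.
move=> hY [gne gop]; rewrite -openC openE => -[x y] /= ngxy.
have [_ cgx] := gne x.
have [|||U [V [oU oV yU gV UV0]]] :=
  (proj1 (@normal_openP R Y) pseudometric_normal) [set y] (g x).
- exact: (accessible_closed_set1 (hausdorff_accessible hY)).
- exact: compact_closed.
- by rewrite -subset0 => _ [-> /ngxy].
exists ([set z | g z `<=` V], U) => /=.
  split; first by apply: open_nbhs_nbhs; split => //; exact: gop.
  by apply: open_nbhs_nbhs; split => //; exact: yU.
move=> [z y'] [/= gzV Uy'] /gzV Vy'.
by suff : set0 y' by []; rewrite -UV0.
Qed.

(** If [f x] and [g x] were disjoint, disjoint open sets around them would contain the values of [f]
    and of [g] near [x], in particular at some point of [D], where these values meet. *)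
Lemma usco_setI (R : realType) (X : topologicalType)
    (Y : pseudoMetricType R) (f g : X -> set Y) (D : set X) :
  hausdorff_space Y -> usco f -> usco g -> dense D ->
  (forall x, D x -> (f x `&` g x) !=set0) ->
  usco (fun x => f x `&` g x).
Proof.
move=> hY uf ug dD fgD; apply: closed_graph_usco.
- move=> x; apply: contrapT => fg0.
  have [[_ cfx] [_ cgx]] := (uf.1 x, ug.1 x).
  have [|||U [V [oU oV fU gV UV0]]] :=
    (proj1 (@normal_openP R Y) pseudometric_normal) (f x) (g x).
  + exact: compact_closed.
  + exact: compact_closed.
  + by rewrite -subset0 => y fgy; apply: fg0; exists y.
  have [z [[fzU gzV] /fgD[y [fzy gzy]]]] :
      ([set z | f z `<=` U] `&` [set z | g z `<=` V]) `&` D !=set0.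
    apply: dD; last by apply: openI; [exact: uf.2|exact: ug.2].
    by exists x.
  by suff : set0 y by []; rewrite -UV0; split; [exact: fzU|exact: gzV].
- have -> : [set p : X * Y | (f p.1 `&` g p.1) p.2] =
      [set p : X * Y | f p.1 p.2] `&` [set p : X * Y | g p.1 p.2] by [].
  by apply: closedI; exact: hausdorff_usco_closed_graph.
- move=> x; exists (f x); split; [exact: (uf.1 x).2|by move=> y []|].
  move=> O oO fxO; have : nbhs x [set z | f z `<=` O].
    by apply: open_nbhs_nbhs; split => //; exact: uf.2.
  by apply: filterS => z fzO y [/fzO].
Qed.

(** The intersection of [f] and [g] is a usco map below [f], hence equal to [f]. *)
Lemma minimal_usco_sub (R : realType) (X : topologicalType)
    (Y : pseudoMetricType R) (f : minimal_usco X Y) (g : X -> set Y)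
    (D : set X) :
  hausdorff_space Y -> usco g -> dense D ->
  (forall x, D x -> (val f x `&` g x) !=set0) -> graph_sub (val f) g.
Proof.
move=> hY ug dD fgD; have [uf fmin] := set_valP f.
have /fmin fgE : usco (fun x => val f x `&` g x).
  exact: (@usco_setI _ _ _ _ _ D).
move=> x y fxy; have : (val f x `&` g x) y; last by case.
by rewrite -[_ `&` _]/((fun x => val f x `&` g x) x) fgE// => z ? [].
Qed.

(** * Points of continuity of minimal usco maps *)

Lemma minimal_usco_small (X Y : topologicalType) (f : minimal_usco X Y)
    (U : set X) (V : set Y) (x : X) (y : Y) :
  open U -> open V -> U x -> V y -> val f x y ->
  exists2 z, U z & val f z `<=` V.
Proof.
move=> oU oV Ux Vy fxy; apply: contrapT => nU.
have fnV z : U z -> exists2 y, val f z y & ~ V y.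
  move=> Uz; apply: contrapT => nV; apply: nU; exists z => // y' fzy'.
  by apply: contrapT => nVy'; apply: nV; exists y'.
have [[fne fop] fmin] := set_valP f.
(* Were no value of [f] over [U] contained in [V], removing [V] from all of
   them would give a strictly smaller usco map. *)
pose h z := [set y' | val f z y' /\ (U z -> ~ V y')].
suff /fmin fh : usco h.
  have : h x y by rewrite fh// => z y' [].
  by case=> _ /(_ Ux).
split=> [z|O oO].
  have [[y' fzy'] cfz] := fne z; split.
    have [/fnV[y'' ? ?]|nUz] := pselect (U z); first by exists y''; split.
    by exists y'; split.
  have [Uz|nUz] := pselect (U z).
    have -> : h z = val f z `&` ~` V.
      by apply/seteqP; split=> t [] // ? /(_ Uz).
    by apply: compact_closedI => //; exact: open_closedC.
  by have -> : h z = val f z by apply/seteqP; split=> t // [].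
(* Over [U], [h z] lies in [O] exactly when [f z] lies in the union of [O] and [V]; off [U], [h] and
   [f] agree. *)
have -> : [set z | h z `<=` O] =
    [set z | val f z `<=` O] `|` (U `&` [set z | val f z `<=` O `|` V]).
  apply/seteqP; split=> z /=.
    have [Uz|nUz] := pselect (U z).
      move=> hzO; right; split=> // t fzt.
      have [Vt|nVt] := pselect (V t); [by right|left].
      exact: hzO.
    by move=> hzO; left => t fzt; apply: hzO; split.
  by move=> [fzO t [/fzO]//|[Uz fzOV] t [/fzOV[]// Vt /(_ Uz)]].
apply: openU; first exact: fop.
by apply: openI => //; apply: fop; exact: openU.
Qed.

(** The points near which all values of [f] lie in one ball of radius 1/(n+1) form an open set,
    dense by [minimal_usco_small]. In a Hausdorff space the condition at [x] forces [f x] to be a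
    singleton. *)
Lemma minimal_usco_continuity_dense (R : realType) (X : topologicalType)
    (Y : pseudoMetricType R) (f : minimal_usco X Y) :
  baire_space X ->
  dense [set x | forall y, val f x y -> forall e : R, 0 < e ->
    \forall z \near x, val f z `<=` ball y e].
Proof.
move=> bX; have [[fne fop] _] := set_valP f.
pose O (n : nat) : set X := [set x : X | exists y,
  \forall z \near x, val f z `<=` ball y (n.+1%:R^-1 : R)].
have : dense (\bigcap_n O n).
  apply: bX => n; split.
    rewrite openE => x [y xy]; rewrite /interior/=.
    by apply: filterS (nbhs_interior xy) => z zy; exists y.
  move=> U [x Ux] oU; have [[y fxy] _] := fne x.
  have yV : (ball y (n.+1%:R^-1 : R))° y.
    by apply: nbhsx_ballx; rewrite invr_gt0 ltr0n.
  have [z Uz fz] := minimal_usco_small oU (@open_interior _ _) Ux yV fxy.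
  exists z; split => //; exists y.
  have : nbhs z [set z | val f z `<=` (ball y (n.+1%:R^-1 : R))°].
    by apply: open_nbhs_nbhs; split=> //; apply: fop; exact: open_interior.
  by apply: filterS => t fty u /fty /interior_subset.
move=> dO U U0 oU; have [x [Ux Ox]] := dO U U0 oU.
exists x; split=> // y fxy e e0.
have : \forall n \near \oo, (n.+1%:R^-1 : R) < e / 2.
  have e20 : 0 < e / 2 by rewrite divr_gt0.
  exact: (near_infty_natSinv_lt (PosNum e20)).
case=> n _ /(_ n (leqnn n)) /= ne.
have [y0 xy0] := Ox n I.
have yy0 := nbhs_singleton xy0 y fxy.
apply: filterS xy0 => z fzy t /fzy ty0.
rewrite [e]splitr; apply: (@ball_triangle _ _ y0).
  by apply: ball_sym; exact: (le_ball (ltW ne)).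
exact: (le_ball (ltW ne)).
Qed.

(** * Graph closures and convergence of sequences of continuous maps *)

(** This is the section over [x] of the closure of the graph of [S] in the product. *)
Definition graph_closure (X Y : topologicalType) (S : X -> set Y) (x : X) :
    set Y :=
  \bigcap_(U in nbhs x) closure (\bigcup_(z in U) S z).

Lemma sub_graph_closure (X Y : topologicalType) (S : X -> set Y) :
  graph_sub S (graph_closure S).
Proof.
move=> x y Sxy U Ux; apply: subset_closure; exists x => //.
exact: nbhs_singleton.
Qed.

Lemma graph_closure_usco (X Y : topologicalType) (S : X -> set Y) :
  hausdorff_space Y -> (forall x, S x !=set0) ->
  (forall x : X, exists2 K, compact K & \forall z \near x, S z `<=` K) ->
  usco (graph_closure S).
Proof.
move=> hY Sne SK; apply: closed_graph_usco.
- by move=> x; have [y Sxy] := Sne x; exists y; exact: sub_graph_closure.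
- rewrite -openC openE => -[x y] /= /existsNP[U /not_implyP[Ux nUy]].
  exists (U°, ~` closure (\bigcup_(z in U) S z)) => /=.
    split; first exact: nbhs_interior.
    apply: open_nbhs_nbhs; split=> //.
    by apply: closed_openC; exact: closed_closure.
  by move=> [z y'] [/= Uz nUy'] /(_ _ Uz).
move=> x; have [K cK xK] := SK x; have clK := compact_closed hY cK.
(* [K] is closed, so a local bound on [S] passes to its graph closure. *)
have gK (z : X) : (\forall t \near z, S t `<=` K) -> graph_closure S z `<=` K.
  move=> zK y /(_ _ zK) cly; apply: clK; apply: closure_subset cly.
  by move=> y' [t /= tK /tK].
exists K; split=> //; first exact: gK.
move=> O oO KO; apply: filterS (nbhs_interior xK) => z zK.
exact: subset_trans (gK z zK) KO.
Qed.

Definition usco_of_continuous (X Y : topologicalType) (phi : X -> Y)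
    (cphi : continuous phi) : minimal_usco X Y :=
  exist (fun g => g \in minimal_usco X Y) _
    (mem_set (continuous_minimal_usco cphi)).

Lemma usco_converges_seq (R : realType) (X : topologicalType)
    (Y : pseudoMetricType R) (phi : nat -> X -> Y)
    (cphi : forall n, continuous (phi n)) (f : minimal_usco X Y) (D : set X) :
  hausdorff_space Y -> dense D ->
  (forall x : X, exists2 K, compact K &
    \forall z \near x, forall n, K (phi n z)) ->
  (forall x y, D x -> val f x y -> forall e : R, 0 < e ->
    \forall n \near \oo & z \near x, ball y e (phi n z)) ->
  usco_converges ((fun n => usco_of_continuous (cphi n)) @ \oo) f.
Proof.
move=> hY dD phiK phif; pose F := (fun n => usco_of_continuous (cphi n)) @ \oo.
(* The graph closures of the tails are usco maps that pin down the limit over [D]. *)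
pose S m z := [set phi n z | n in [set n | (m <= n)%N]].
pose g m := graph_closure (S m).
have ug m : usco (g m).
  apply: graph_closure_usco => // x; first by exists (phi m x), m => /=.
  have [K cK xK] := phiK x; exists K => //.
  by apply: filterS xK => z zK _ [n _ <-].
have Fg m : F (minimal_below (g m)).
  exists m => // n /= mn x _ /= ->; apply: sub_graph_closure.
  by exists n.
have [uf _] := set_valP f; have [fne _] := uf.
split; first by exists (g 0%N); split; [exact: ug|exact: Fg].
(* For large [n], [h x] contains [phi n x]; being closed, it contains the limit [y] when [x] is in
   [D]. *)
have fg h : usco h -> F (minimal_below h) -> graph_sub (val f) h.
  move=> uh [N _ Nh]; apply: (minimal_usco_sub hY uh dD) => x Dx.
  have [[y fxy] _] := fne x; exists y; split => //.
  have cl : closed (h x) by apply: compact_closed => //; exact: (uh.1 x).2.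
  apply: cl => U; rewrite -nbhs_ballE => -[e /= e0 yU].
  have [[A B] [/= [M _ MA] Bx] AB] := phif x y Dx fxy e e0.
  exists (phi (maxn N M) x); split.
    by apply: (Nh (maxn N M)) => //=; exact: leq_maxl.
  apply: yU; apply: (AB (_, _)) => /=; split; last exact: nbhs_singleton.
  by apply: MA => /=; exact: leq_maxr.
apply/seteqP; split=> [_ -> h [uh Fh]|f' f'F]; first exact: (fg h uh Fh).
have [uf' f'min] := set_valP f'.
(* This direction suffices because [f'] is minimal. For [x] in [D], a value [y'] of [f'] at [x] is
   approached by points [phi n z] with [n] large and [z] near [x]; these are also close to [y], so
   [y' = y]. *)
suff ff' : graph_sub (val f) (val f').
  by apply/val_inj/esym/f'min.
apply: (minimal_usco_sub hY uf' dD) => x Dx.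
have [[y fxy] _] := fne x; have [[y' f'xy'] _] := uf'.1 x.
exists y; split => //; suff <- : y' = y by [].
apply: hY => U V.
move=> /(@nbhs_ballP R Y)[e' /= e'0 yU] /(@nbhs_ballP R Y)[e /= e0 yV].
have [[A B] [/= [M _ MA] Bx] AB] := phif x y Dx fxy e e0.
have : g M x y'.
  by apply: (f'F (g M)) => //; split; [exact: ug|exact: Fg].
move=> /(_ B Bx _ (nbhsx_ballx _ _ e'0))[_ [[z Bz [n Mn <-]] y'n]].
exists (phi n z); split; [exact: yU|apply: yV].
by apply: (AB (_, _)) => /=; split => //; exact: MA.
Qed.

(** * Lipschitz regularization by infimal convolution *)

Section inf_convolution.
Context {R : realType} {X : metricType R}.
Implicit Types (w : X -> R) (k a b : R) (x y z : X).

(* Pasch-Hausdorff envelope: the largest [k]-Lipschitz minorant of [w]. *)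
Definition infconv w k x : R := inf [set w z + k * mdist x z | z in setT].

(** The lower bound on [w] makes the infimum genuine: on a set unbounded below, [inf] is only a
    default value. *)
Lemma infconv_le w k a x z : (forall t, a <= w t) -> 0 <= k ->
  infconv w k x <= w z + k * mdist x z.
Proof.
move=> aw k0; apply: ge_inf; last by exists z.
exists a => _ [t _ <-]; rewrite (le_trans (aw t))// lerDl mulr_ge0//.
exact: mdist_ge0.
Qed.

Lemma infconv_le_diag w k a x : (forall t, a <= w t) -> 0 <= k ->
  infconv w k x <= w x.
Proof.
move=> aw k0; rewrite (le_trans (infconv_le x x aw k0))//.
by rewrite mdistxx mulr0 addr0.
Qed.

Lemma le_infconv w k a x : (forall z, a <= w z + k * mdist x z) ->
  a <= infconv w k x.
Proof.
move=> aw; apply: lb_le_inf; first by exists (w x + k * mdist x x), x.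
by move=> _ [z _ <-].
Qed.

Lemma infconv_lipschitz w k a x y : (forall t, a <= w t) -> 0 <= k ->
  `|infconv w k x - infconv w k y| <= k * mdist x y.
Proof.
move=> aw k0.
have lip u v : infconv w k u - k * mdist u v <= infconv w k v.
  apply: le_infconv => z; rewrite lerBlDr (le_trans (infconv_le u z aw k0))//.
  by rewrite -addrA -mulrDr lerD2l ler_wpM2l// addrC metric_triangle.
by rewrite ler_distl -lerBlDr lip andbT metric_sym lip.
Qed.

Lemma infconv_continuous w k a : (forall t, a <= w t) -> 0 <= k ->
  continuous (infconv w k).
Proof.
move=> aw k0 x; apply/cvgrPdist_lt => e e0.
have k1 : 0 < k + 1 by rewrite ltr_wpDl.
apply/metricType_numDomainType.nbhs_mdistP; exists (e / (k + 1)).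
  exact: divr_gt0.
move=> y /=; rewrite ltr_pdivlMr// mulrC; apply: le_lt_trans.
rewrite (le_trans (infconv_lipschitz x y aw k0))//.
by rewrite ler_wpM2r ?mdist_ge0// lerDl.
Qed.

(** Points within [r] of [x] contribute at least [a], all others at least [k * r]. *)
Lemma infconv_gt0 w k x : (forall t, 0 < w t) -> 0 < k ->
  (exists2 a, 0 < a & \forall z \near x, a <= w z) -> 0 < infconv w k x.
Proof.
move=> w0 k0 [a a0 /metricType_numDomainType.nbhs_mdistP[r /= r0 xr]].
apply: (@lt_le_trans _ _ (Num.min a (k * r))).
  by rewrite lt_min a0/= mulr_gt0.
apply: le_infconv => z; rewrite ge_min.
have [zr|zr] := ltP (mdist x z) r.
  by rewrite (le_trans (xr _ zr))// lerDl mulr_ge0// ?mdist_ge0// ltW.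
by rewrite orbC (le_trans (ler_wpM2l (ltW k0) zr))// lerDr ltW.
Qed.

(** The upper bound comes from [w z] itself. For the lower one, points [t] within [r] of [x] have
    [w t] close to [w x]; the others are at least [r / 2] away from [z], so for large [n] their
    penalty exceeds the oscillation [b - a] and lifts the sum to [b] or more. *)
Lemma infconv_cvg w a b x : (forall t, a <= w t <= b) ->
  w z @[z --> x] --> w x ->
  infconv w p.1%:R p.2 @[p --> filter_prod \oo (nbhs x)] --> w x.
Proof.
move=> wab cwx; apply/cvgrPdist_le => e e0.
have aw t : a <= w t by case/andP: (wab t).
have bw t : w t <= b by case/andP: (wab t).
move/cvgrPdist_le : cwx => /(_ e e0).
move=> /metricType_numDomainType.nbhs_mdistP[r /= r0 xr].
have r2 : 0 < r / 2 by rewrite divr_gt0.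
exists ([set n | (b - a) / (r / 2) <= n%:R], [set z | mdist x z < r / 2]).
  split; first exact: nbhs_infty_ger.
  by apply/metricType_numDomainType.nbhs_mdistP; exists (r / 2).
move=> [n z] [/= bn xz].
have xrz t : mdist x t < r -> `|w x - w t| <= e by exact: xr.
rewrite ler_distlC; apply/andP; split.
  apply: le_infconv => t; have [xt|xt] := ltP (mdist x t) r.
    have := xrz t xt; rewrite ler_distlC => /andP[+ _] => /le_trans; apply.
    by rewrite lerDl mulr_ge0// mdist_ge0.
  have zt : r / 2 <= mdist z t.
    have := le_trans xt (metric_triangle x z t).
    rewrite {1}[r]splitr => h; rewrite -(lerD2l (r / 2)) (le_trans h)//.
    by rewrite lerD2r ltW.
  rewrite (@le_trans _ _ b)//.
    by rewrite lerBlDr (le_trans (bw x))// lerDl ltW.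
  rewrite -lerBlDl (@le_trans _ _ (b - a))// ?lerB//.
  rewrite ler_pdivrMr// in bn; rewrite (le_trans bn)//.
  by rewrite ler_wpM2l.
rewrite (le_trans (infconv_le_diag _ aw _))//.
have : mdist x z < r by rewrite (lt_trans xz)// ltr_pdivrMr// ltr_pMr// ltr1n.
by move=> /xrz; rewrite ler_distlC => /andP[].
Qed.

End inf_convolution.

(** * Nearest-point projection onto a closed convex set *)

Section euclidean_projection.
Context {R : realType} {d : nat}.
Implicit Types u v p q : 'rV[R]_d.

(** The norm of row vectors is the maximum norm, so the Euclidean structure is carried by this form;
    the two are compared below. *)
Definition dotv u v : R := \sum_i u 0 i * v 0 i.

Lemma dotvC u v : dotv u v = dotv v u.
Proof. by apply: eq_bigr => i _; rewrite mulrC. Qed.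

Lemma dotvDl u v p : dotv (u + v) p = dotv u p + dotv v p.
Proof. by rewrite -big_split; apply: eq_bigr => i _; rewrite mxE mulrDl. Qed.

Lemma dotvNl u v : dotv (- u) v = - dotv u v.
Proof. by rewrite -sumrN; apply: eq_bigr => i _; rewrite mxE mulNr. Qed.

Lemma dotvZl k u v : dotv (k *: u) v = k * dotv u v.
Proof. by rewrite mulr_sumr; apply: eq_bigr => i _; rewrite mxE mulrA. Qed.

Lemma dotv_ge0 u : 0 <= dotv u u.
Proof. by apply: sumr_ge0 => i _; rewrite -expr2 sqr_ge0. Qed.

Lemma dotv_sqrD u v : dotv (u + v) (u + v) = dotv u u + 2 * dotv u v + dotv v v.
Proof.
rewrite dotvDl !(dotvC _ (u + v)) !dotvDl (dotvC v u).
by rewrite mulr2n mulrDl mul1r !addrA.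
Qed.

Lemma normrV_coord v i : `|v 0 i| <= `|v|.
Proof.
rewrite [leRHS]/Num.norm /= mx_normrE.
by apply/bigmax_geP; right; exists (0, i).
Qed.

Lemma normrV_sqr_le_dotv v : `|v| ^+ 2 <= dotv v v.
Proof.
have [->|v0] := eqVneq v 0; first by rewrite normr0 expr0n/= dotv_ge0.
have [[i j] /= vij] : exists ij : 'I_1 * 'I_d, `|v| = `|v ij.1 ij.2|.
  by apply: mx_norm_neq0; rewrite -normr_eq0 in v0.
rewrite vij (ord1 i) real_normK ?num_real// expr2 /dotv (bigD1 j)//= lerDl.
by apply: sumr_ge0 => k _; rewrite -expr2 sqr_ge0.
Qed.

Lemma dotv_le_normrV_sqr v : dotv v v <= d%:R * `|v| ^+ 2.
Proof.
rewrite /dotv (@le_trans _ _ (\sum_(i < d) `|v| ^+ 2))//.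
  apply: ler_sum => i _; rewrite -expr2 -[leLHS]real_normK ?num_real//.
  by rewrite lerXn2r ?nnegrE// normrV_coord.
by rewrite sumr_const card_ord mulr_natl.
Qed.

Lemma dotv_continuous p : continuous (fun u => dotv (u - p) (u - p)).
Proof.
rewrite (_ : (fun u => _) = fun u => \sum_i (u 0 i - p 0 i) * (u 0 i - p 0 i)).
  apply: continuous_big => [|i _ u]; first exact: add_continuous.
  have ci : v 0 i - p 0 i @[v --> u] --> u 0 i - p 0 i.
    by apply: cvgB; [exact: coord_continuous|exact: cvg_cst].
  exact: (cvgM ci ci).
by apply/funext => u; apply: eq_bigr => i _; rewrite !mxE.
Qed.

Section nearest_point.
Variable Y : set 'rV[R]_d.
Hypotheses (cY : closed Y) (vY : convex_set (M := 'rV[R]_d) Y).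

Lemma nearest_point_ex v : Y !=set0 -> exists2 p, Y p &
  forall q, Y q -> dotv (p - v) (p - v) <= dotv (q - v) (q - v).
Proof.
move=> [y0 Yy0]; pose r := dotv (y0 - v) (y0 - v).
pose A := Y `&` [set p | dotv (p - v) (p - v) <= r].
have cA : compact A.
  apply: bounded_closed_compact.
    (* Either [p - v] has norm at most 1, or its norm is at most its square, hence at most [r]; no
       square root is needed. *)
    exists (`|v| + (r + 1)); split; first exact: num_real.
    move=> M rM p [_ /= pr]; rewrite (le_trans _ (ltW rM))//.
    rewrite -[p](subrK v) addrC (le_trans (ler_normD _ _))// lerD2l.
    have : `|p - v| ^+ 2 <= r by exact: le_trans (normrV_sqr_le_dotv _) pr.
    have [pv1 _|pv1 pvr] := leP `|p - v| 1.
      by rewrite (le_trans pv1)// lerDr dotv_ge0.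
    rewrite (@le_trans _ _ (`|p - v| ^+ 2))//; last by rewrite ler_wpDr.
    by rewrite expr2 ler_peMl// ltW.
  apply: closedI => //.
  rewrite (_ : [set p | _] =
    (fun p => dotv (p - v) (p - v)) @^-1` [set t | t <= r])//.
  apply: (proj1 (continuous_closedP _)); last exact: closed_le.
  exact: dotv_continuous.
have [|||p /set_mem[Yp _] pmin] :=
  @compact_EVT_min _ R (fun p => dotv (p - v) (p - v)) A.
- by exists y0; split => /=.
- exact: cA.
- by apply: continuous_subspaceT; exact: dotv_continuous.
exists p => // q Yq; have [qr|rq] := leP (dotv (q - v) (q - v)) r.
  by apply: pmin; apply/mem_set.
rewrite (le_trans _ (ltW rq))//; apply: pmin; apply/mem_set; split => //=.
Qed.

(** Moving from [p] towards [q] by a fraction [t] changes the squared distance to [v] by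
    [t^2 * S - 2 * t * D], which is negative if [D > 0] and [t] is so small that [t * S <= D]. *)
Lemma nearest_point_obtuse v p : Y p ->
  (forall q, Y q -> dotv (p - v) (p - v) <= dotv (q - v) (q - v)) ->
  forall q, Y q -> dotv (q - p) (v - p) <= 0.
Proof.
move=> Yp pmin q Yq; rewrite leNgt; apply/negP => D0.
set D := dotv _ _ in D0; pose S := dotv (q - p) (q - p).
have S0 : 0 <= S by exact: dotv_ge0.
have [t [t0 t1 tSD]] : exists t : R, [/\ 0 < t, t <= 1 & t * S <= D].
  have S1 : 0 < S + 1 by rewrite ltr_wpDl.
  (* The minimum with 1 keeps the point on the segment; [S + 1] avoids a zero denominator. *)
  exists (Num.min 1 (D / (S + 1))); split.
  - by rewrite lt_min ltr01 divr_gt0.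
  - by rewrite ge_min lexx.
  - rewrite (@le_trans _ _ (D / (S + 1) * S))//.
      by rewrite ler_wpM2r// ge_min lexx orbT.
    by rewrite mulrAC ler_pdivrMr// ler_wpM2l ?ltW// ltrDl.
have : Y (p + t *: (q - p)).
  have := @vY q p (Itv01 (ltW t0) t1) (mem_set Yq) (mem_set Yp).
  move/set_mem; rewrite /conv/= /unstable.onem => h.
  rewrite (_ : p + _ = t *: q + (1 - t) *: p)//.
  by rewrite scalerBr scalerBl scale1r addrCA addrC.
move=> /pmin; rewrite addrAC (dotv_sqrD (p - v)) -addrA lerDl.
rewrite dotvZl !(dotvC _ (t *: _)) !dotvZl.
rewrite -/S (_ : dotv (q - p) (p - v) = - D); last first.
  by rewrite -[p - v]opprB dotvC dotvNl dotvC.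
nra.
Qed.

(* If [Y] is empty, [P] is an arbitrary continuous map. *)
Lemma retraction_closed_convex : exists P : 'rV[R]_d -> 'rV[R]_d,
  [/\ continuous P, forall v, Y v -> P v = v & forall v, Y !=set0 -> Y (P v)].
Proof.
have [Y0|Y0] := pselect (Y !=set0); last first.
  exists id; split=> // v; first exact: cvg_id.
have /choice[P YP] v : exists p, Y p /\
    forall q, Y q -> dotv (p - v) (p - v) <= dotv (q - v) (q - v).
  by have [p Yp pmin] := nearest_point_ex v Y0; exists p.
have obt v := nearest_point_obtuse (YP v).1 (YP v).2.
have lip u v : dotv (P v - P u) (P v - P u) <= dotv (v - u) (v - u).
  (* |v - u|^2 = |Pv - Pu|^2 + 2 <Pv - Pu, (v - Pv) - (u - Pu)> + ..., where the
     cross term is nonnegative by the obtuse angle property. *)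
  have -> : v - u = (P v - P u) + (v - P v - (u - P u)).
    by apply/matrixP => i j; rewrite !mxE; ring.
  rewrite (dotv_sqrD (P v - P u)) -addrA lerDl addr_ge0 ?dotv_ge0// mulr_ge0//.
  rewrite dotvC dotvDl dotvNl !(dotvC _ (P v - P u)) subr_ge0.
  rewrite (le_trans (obt u _ (YP v).1))//.
  by rewrite -opprB dotvNl oppr_ge0 (obt v _ (YP u).1).
(* Changing norms costs a factor sqrt(d), enlarged to [d + 1] to avoid the root and to stay positive
   when [d = 0]. *)
have lipn u v : `|P v - P u| <= (d%:R + 1) * `|v - u|.
  rewrite -(@ler_pXn2r _ 2)// ?nnegrE// ?mulr_ge0 ?addr_ge0//.
  rewrite (le_trans (normrV_sqr_le_dotv _))// (le_trans (lip u v))//.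
  rewrite (le_trans (dotv_le_normrV_sqr _))// exprMn ler_wpM2r ?sqr_ge0//.
  rewrite expr2 (@le_trans _ _ (d%:R + 1))// ?lerDl//.
  by rewrite ler_peMl// ?addr_ge0// lerDr.
exists P; split=> //.
- move=> v; apply/(@cvgrPdist_lt R 'rV[R]_d _ (nbhs v) (nbhs_filter v)) => e e0.
  have d1 : 0 < d%:R + 1 :> R by rewrite ltr_wpDl.
  have : nbhs v (ball v (e / (d%:R + 1))).
    by apply: nbhsx_ballx; exact: divr_gt0.
  apply: filterS => u; rewrite -ball_normE /= ltr_pdivlMr// mulrC distrC.
  by move=> uv; rewrite distrC (le_lt_trans (lipn _ _)).
- move=> v Yv; apply/eqP.
  rewrite -subr_eq0 -normr_eq0 -sqrf_eq0 eq_le sqr_ge0 andbT.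
  rewrite (le_trans (normrV_sqr_le_dotv _))// (le_trans ((YP v).2 v Yv))//.
  by rewrite subrr /dotv big1// => i _; rewrite mxE mul0r.
- by move=> v _; exact: (YP v).1.
Qed.

End nearest_point.
End euclidean_projection.

(** * Subspaces, coordinatewise limits and local boundedness *)

Lemma set_val_continuous (T : topologicalType) (A : set T) :
  continuous (val : A -> T).
Proof. exact: initial_continuous. Qed.

Lemma set_type_hausdorff (T : topologicalType) (A : set T) :
  hausdorff_space T -> hausdorff_space A.
Proof.
move=> hT x y xy; apply/val_inj/hT => U V xU yV.
have [z [Uz Vz]] := xy _ _ (set_val_continuous xU) (set_val_continuous yV).
by exists (val z).
Qed.

(** The inclusion of [K] in [A] makes the cluster point found in [T] a point of [A]. *)
Lemma compact_preimage_val (T : topologicalType) (A K : set T) :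
  compact K -> K `<=` A -> compact ((val : A -> T) @^-1` K).
Proof.
move=> cK KA F FF FK.
have [t [Kt Ft]] := cK (val @ F) _ FK.
have [x xt] : exists x : A, val x = t by exists (exist _ t (mem_set (KA _ Kt))).
exists x; split; first by rewrite /= xt.
move=> B W FB [_ [[U oU <-] /= Ux] UV].
have FB' : F (val @^-1` (val @` B)) by apply: filterS FB => z Bz; exists z.
have tU : nbhs t U by rewrite -xt; exact: open_nbhs_nbhs.
have [_ [[z Bz <-] Uz]] := Ft _ _ FB' tU.
by exists z; split => //; exact: UV.
Qed.

Lemma cvg_rV (R : realType) (d : nat) (I : Type) (F : set_system I)
    (g : I -> 'rV[R]_d) (v : 'rV[R]_d) : Filter F ->
  (forall j, g i 0 j @[i --> F] --> v 0 j) -> g i @[i --> F] --> v.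
Proof.
move=> FF gv; apply/cvg_ballP => e e0.
have : \forall i \near F, forall j, ball (v 0 j) e (g i 0 j).
  apply: filter_forall => j; move/cvg_ballP : (gv j); exact.
by apply: filterS => i gi; split=> // k j; rewrite (ord1 k).
Qed.

Lemma usco_locally_bounded (R : realType) (X : topologicalType)
    (V : normedModType R) (Y : set V) (f : X -> set Y) (x : X) :
  usco f -> exists2 M : R, 0 < M &
    \forall z \near x, forall y, f z y -> `|val y| < M.
Proof.
move=> [fne fop]; have [_ cfx] := fne x.
have cv : compact (val @` f x).
  apply: continuous_compact => //; apply: continuous_subspaceT.
  exact: set_val_continuous.
have [M [_ fM]] := compact_bounded cv.
(* The compact image is bounded by [|M| + 1]; one more unit makes the inequality strict, hence an
   open condition that spreads to nearby points. *)
exists (`|M| + 2); first by rewrite ltr_wpDl.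
have : nbhs x [set z | f z `<=` val @^-1` [set v : V | `|v| < `|M| + 2]].
  apply: open_nbhs_nbhs; split.
    apply: fop; apply: open_comp => [y _|]; first exact: set_val_continuous.
    apply: (@open_comp V R (fun v => `|v|) [set t | t < `|M| + 2]).
      by move=> v _; exact: norm_continuous.
    exact: open_lt.
  move=> y fxy /=; rewrite (@le_lt_trans _ _ (`|M| + 1))//.
    apply: (fM (`|M| + 1)); last by exists y.
    by rewrite (le_lt_trans (ler_norm _))// ltrDl.
  by rewrite ltrD2l ltr1n.
by apply: filterS => z fz y /fz.
Qed.

(** * Continuous approximation of a locally bounded map *)

(** The bounds uniform in [n] and the joint convergence are what [usco_converges_seq] asks for, once
    the values are projected onto [Y]. *)
Lemma locally_bounded_approximation (R : realType) (X : metricType R)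
    (d : nat) (s : X -> 'rV[R]_d) :
  (forall x : X, exists2 M : R, 0 < M & \forall z \near x, `|s z| < M) ->
  exists F : nat -> X -> 'rV[R]_d, [/\ forall n, continuous (F n),
    forall x : X, exists M : R, \forall z \near x, forall n, `|F n z| <= M &
    forall x, s z @[z --> x] --> s x ->
      F p.1 p.2 @[p --> filter_prod \oo (nbhs x)] --> s x].
Proof.
move=> sM.
(* The weight [rho] is Lipschitz, positive, and makes [s * rho] bounded. *)
pose r z := (1 + `|s z|)^-1.
have r0 z : 0 < r z by rewrite invr_gt0 ltr_wpDr.
pose rho : X -> R := infconv r 1.
have rho0 x : 0 < rho x.
  apply: infconv_gt0 => //; have [M M0 sxM] := sM x.
  exists (1 + M)^-1; first by rewrite invr_gt0 ltr_wpDl.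
  apply: filterS sxM => z szM; rewrite /r lef_pV2 ?posrE ?ltr_wpDr ?(ltW M0)//.
  by rewrite lerD2l ltW.
have rho_cont : continuous rho.
  by apply: (@infconv_continuous _ _ _ _ 0) => // t; exact: ltW.
have rho_le z : `|s z| * rho z <= 1.
  have : rho z <= r z.
    by apply: (@infconv_le_diag _ _ _ _ 0) => // t; exact: ltW.
  rewrite /r -[X in _ <= X]mul1r ler_pdivlMr ?ltr_wpDr//; apply: le_trans.
  by rewrite mulrDr mulr1 mulrC ler_wpDl// ltW.
pose w i z := s z 0 i * rho z.
have w1 i z : -1 <= w i z <= 1.
  rewrite -ler_norml normrM (gtr0_norm (rho0 z)) (le_trans _ (rho_le z))//.
  by rewrite ler_wpM2r ?normrV_coord// ltW.
have w1l i z : -1 <= w i z by case/andP: (w1 i z).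
pose F n z := \row_i (infconv (w i) n%:R z / rho z).
have wn1 i n z : `|infconv (w i) n%:R z| <= 1.
  rewrite ler_norml; apply/andP; split.
    apply: le_infconv => t; rewrite (le_trans (w1l i t))//.
    by rewrite lerDl mulr_ge0// mdist_ge0.
  rewrite (le_trans (infconv_le_diag z (w1l i) _))//.
  by case/andP: (w1 i z).
exists F; split.
- move=> n x; apply: cvg_rV => i; rewrite mxE.
  under eq_fun do rewrite mxE.
  apply: cvgM; last by apply: cvgV; [rewrite gt_eqF|exact: rho_cont].
  exact: (infconv_continuous (w1l i)).
(* The regularized coordinates stay in [-1, 1], and [rho] exceeds [rho x / 2] near [x]. *)
- move=> x; exists (2 / rho x).
  have : \forall z \near x, rho x / 2 < rho z.
    apply: (cvgr_gt (rho x)); first exact: rho_cont.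
    by rewrite ltr_pdivrMr// ltr_pMr// ltr1n.
  apply: filterS => z rz n.
  rewrite [leLHS]/Num.norm /= mx_normrE.
  apply/bigmax_leP; split=> [|[k i] _ /=].
    by rewrite divr_ge0// ltW.
  rewrite mxE normrM normfV (gtr0_norm (rho0 z)) ler_pdivrMr//.
  rewrite (le_trans (wn1 i n z))// mulrAC ler_pdivlMr// mul1r.
  by rewrite -ler_pdivrMl// mulrC ltW.
- move=> x sx; apply: cvg_rV => i.
  have six : s z 0 i @[z --> x] --> s x 0 i.
    apply: (cvg_comp s (fun v : 'rV[R]_d => v 0 i) sx).
    exact: coord_continuous.
  have wx : w i z @[z --> x] --> w i x.
    by apply: cvgM; [exact: six|exact: rho_cont].
  have -> : s x 0 i = w i x / rho x by rewrite /w mulfK// gt_eqF.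
  under eq_fun do rewrite mxE.
  apply: cvgM; first exact: (infconv_cvg (w1 i)).
  apply: cvgV; first by rewrite gt_eqF.
  by apply: (cvg_comp snd rho (@cvg_snd _ _ _ _ _)); exact: rho_cont.
Qed.

(** * Density of the continuous maps *)

Theorem theorem37 (R : realType) (X : metricType R) (hX : baire_space X)
    (d : nat) (Y : set 'rV[R]_d) (cY : closed Y)
    (vY : convex_set (M := 'rV[R]_d) Y) :
  usco_dense (continuous_usco X (set_type Y)).
Proof.
apply/seteqP; split=> // f _ B [cB CB].
have [uf _] := set_valP f.
have hY : hausdorff_space Y by apply: set_type_hausdorff; exact: norm_hausdorff.
have [s fs] : {s : X -> Y & forall x, val f x (s x)}.
  by apply: (@choice _ _ (fun x y => val f x y)) => x; exact: (uf.1 x).1.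
have sM (x : X) : exists2 M : R, 0 < M & \forall z \near x, `|val (s z)| < M.
  have [M M0 fM] := usco_locally_bounded x uf.
  by exists M => //; apply: filterS fM => z; apply.
have [F [cF bF Fs]] := locally_bounded_approximation sM.
have [P [cP PY YP]] := retraction_closed_convex cY vY.
(* A point of [X] provides a point of [Y], so an empty [Y] (with [X] empty) needs no separate
   case. *)
have Y0 (x : X) : Y !=set0 by exists (val (s x)); exact: set_valP.
pose phi n x : Y :=
  exist (fun v => v \in Y) (P (F n x)) (mem_set (YP _ (Y0 x))).
have cphi n : continuous (phi n).
  apply: (@continuous_comp_initial _ X 'rV[R]_d val) => x.
  exact: (continuous_comp (cF n x) (cP (F n x))).
apply: (cB ((fun n => usco_of_continuous (cphi n)) @ \oo)); last first.
  by exists 0%N => // n _; apply: CB; exists (phi n).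
apply: (usco_converges_seq cphi hY (minimal_usco_continuity_dense f hX)).
(* The compact set is the image under [P] of a closed ball. *)
- move=> x; have [M FM] := bF x.
  exists (val @^-1` (P @` [set v | `|v| <= M])).
    apply: compact_preimage_val; last by move=> _ [v _ <-]; exact: YP (Y0 x).
    apply: continuous_compact; first exact: continuous_subspaceT.
    apply: bounded_closed_compact.
      exists M; split => [|N MN v /= vM]; first exact: num_real.
      by rewrite (le_trans vM)// ltW.
    apply: (@closed_comp 'rV[R]_d R (fun v => `|v|) [set t | t <= M]).
      by move=> v _; exact: norm_continuous.
    exact: closed_le.
  by apply: filterS FM => z Fz n; exists (F n z); first exact: Fz.
- move=> x y Dx fxy e e0.
  have sv y' : val f x y' -> val (s z) @[z --> x] --> val y'.
    move=> fxy'; apply/cvg_ballP => e' e'0.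
    by apply: filterS (Dx _ fxy' e' e'0) => z; exact.
  (* Both points are limits of [s z] as [z] tends to [x]. *)
  have -> : y = s x.
    apply/val_inj; apply: (cvg_unique _ (sv _ fxy) (sv _ (fs x))).
    exact: norm_hausdorff.
  have PFs : P (F p.1 p.2) @[p --> filter_prod \oo (nbhs x)] --> val (s x).
    rewrite -[X in _ --> X]PY; last exact: set_valP.
    by apply: (cvg_comp _ _ (Fs x (sv _ (fs x)))); exact: cP.
  exact: (cvg_ball PFs e0).
Qed.
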